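(* Let $(G,\gamma)$ be an edge-colored graph with $n$ vertices, $m$ edges, and $\ell\geq 2$ colors. Suppose that $s>0$ of the colors are each used exactly once in the graph, while each of the other $\ell-s$ colors is used exactly twice. If $n-2>\ell-s$, then $\operatorname{wld}(G)=n-1$.
   Context: An edge-colored graph $(G,\gamma)$ is a finite connected graph $G$ with a surjective function $\gamma:E(G)\to\mathcal{C}=\{c_1,\dots,c_\ell\}$ onto a finite set of colors (not necessarily a proper edge-coloring). For each color $c_i$ let $E_i(G)=\{e\in E(G):\gamma(e)=c_i\}$; the color $c_i$ is used exactly $t$ times if $|E_i(G)|=t$. For $W\subseteq E(G)$, let $G_i^W$ be the graph with vertex set $V(G)$ and edge set $W\cup E_i(G)$. The set $W$ is color-connecting if $G_i^W$ is connected for every color $c_i\in\mathcal{C}$. The wild number $\operatorname{wld}(G)$ is the minimum size of a color-connecting set. *)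

(* Defs.v *)
From mathcomp Require Import all_boot.

Set Implicit Arguments.
Unset Strict Implicit.
Unset Printing Implicit Defensive.

(* Finite undirected graphs, with parallel edges and loops allowed: a loop is
   an edge with exactly one end.  Simple graphs are the case where [ends] is
   injective with values of cardinal 2. *)
Record graph := Graph {
  vertex : finType;
  edge : finType;
  ends : edge -> {set vertex};
  card_ends : forall e, 0 < #|ends e| <= 2
}.

Definition adj (G : graph) (F : {set edge G}) : rel (vertex G) :=
  fun x y => [exists e in F, ends e == [set x; y]].

(* The spanning subgraph with vertex set [vertex G] and edge set [F] is
   connected. *)
Definition span_connected (G : graph) (F : {set edge G}) : bool :=
  (0 < #|vertex G|) && [forall x, forall y, connect (adj F) x y].

Record ecgraph (C : finType) := ECGraph {
  ecgraph_graph :> graph;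
  color : edge ecgraph_graph -> C;
  ecgraph_connected : span_connected [set: edge ecgraph_graph];
  color_surj : forall c : C, exists e, color e = c
}.

Section WildNumber.
Variables (C : finType) (G : ecgraph C).

Definition color_class (c : C) : {set edge G} := [set e | color e == c].

Definition used_exactly (c : C) (t : nat) : Prop := #|color_class c| = t.

Definition color_connecting (W : {set edge G}) : bool :=
  [forall c : C, span_connected (W :|: color_class c)].

Lemma color_connectingT : color_connecting [set: edge G].
Proof. by apply/forallP => c; rewrite setTU; apply: ecgraph_connected. Qed.

(* [color_connectingT] makes the default value of [arg min] admissible, so
   this is the true minimum. *)
Definition wld : nat :=
  #|[arg min_(W < [set: edge G] | color_connecting W) #|W| ]|.

Lemma wldP :
  (exists2 W, color_connecting W & #|W| = wld) /\
  (forall W, color_connecting W -> wld <= #|W|).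
Proof.
rewrite /wld; case: arg_minnP => [|W ccW minW]; first exact: color_connectingT.
by split; first exists W.
Qed.

End WildNumber.

(* Main.v *)
Require Import Defs.
From mathcomp Require Import all_boot.

(** A connected graph on [n] vertices contains a spanning tree, which has
    [n - 1] edges; this bounds the wild number from above, and shows that a
    set [W] of fewer than [n - 1] edges is not connected. If such a [W] is
    color-connecting, it contains no color class, so it avoids every color used
    once and has at most one edge of every color used twice: [#|W| <= l - s].
    But adding the single edge of a color used once makes [W] connected, so
    [n - 2 <= #|W|], a contradiction. *)

Section SpanningTree.

Set Implicit Arguments.
Unset Strict Implicit.
Unset Printing Implicit Defensive.

Variable G : graph.
Implicit Types (F T : {set edge G}) (X : {set vertex G}).

Lemma adj_sym F : symmetric (adj F).
Proof. by move=> x y; apply: eq_existsb => e; rewrite setUC. Qed.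

Lemma connect_adjS F F' : F \subset F' ->
  subrel (connect (adj F)) (connect (adj F')).
Proof.
move=> sFF'; apply: connect_sub => x y /exists_inP[e eF eE].
by apply/connect1/exists_inP; exists e; rewrite // (subsetP sFF').
Qed.

Lemma span_connectedS F F' : F \subset F' ->
  span_connected F -> span_connected F'.
Proof.
move=> sFF' /andP[V0 cF]; rewrite /span_connected V0 /=.
apply/'forall_forallP => x y; apply: connect_adjS sFF' _ _ _.
exact: 'forall_forallP cF x y.
Qed.

(** If no edge of [F] left [X], then [X] would be closed under adjacency, hence under [connect], and
    would contain [y]. *)
Lemma crossing_edge F X x y : connect (adj F) x y -> x \in X -> y \notin X ->
  exists e u v, [/\ e \in F, u \in X, v \notin X & ends e = [set u; v]].
Proof.
move=> cxy xX yX.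
have [/exists_inP[u uX /exists_inP[v vX /exists_inP[e eF /eqP eE]]]|noE] :=
  boolP [exists u in X, exists v in ~: X, adj F u v].
  by exists e, u, v; split; rewrite // -in_setC.
case/negP: yX; rewrite -(closed_connect _ cxy) //.
apply: intro_closed => [|u v uv uX]; first exact/sym_connect_sym/adj_sym.
apply: contraNT noE => vX; apply/exists_inP; exists u => //.
by apply/exists_inP; exists v; rewrite ?inE.
Qed.

(* The condition on the ends of [T] ensures that an edge leaving [X] is new. *)
Lemma partial_tree F k : span_connected F -> k < #|vertex G| ->
  exists r X T, [/\ T \subset F, #|T| = k, #|X| = k.+1,
    forall e, e \in T -> ends e \subset X
    & forall x, x \in X -> connect (adj T) r x].
Proof.
move=> /andP[/card_gt0P[r0 _] /'forall_forallP cF].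
elim: k => [|k IHk] ltk.
  exists r0, [set r0], set0; split; rewrite ?sub0set ?cards0 ?cards1 //.
    by move=> e; rewrite inE.
  by move=> x /set1P->.
have [r [X [T [sTF cT cX eT rT]]]] := IHk (ltnW ltk).
have [x xX] : exists x, x \in X by apply/card_gt0P; rewrite cX.
have [y yX] : exists y, y \notin X.
  have /card_gt0P[y] : 0 < #|~: X| by rewrite cardsCs setCK cX subn_gt0.
  by rewrite inE; exists y.
(* The tree grows by one edge [e] leaving [X], whose outer end [v] becomes a new leaf attached at
   [u]. *)
have [e [u [v [eF uX vX eE]]]] := crossing_edge (cF x y) xX yX.
have eNT : e \notin T.
  by apply: contra vX => /eT/subsetP->; rewrite // eE set22.
exists r, (v |: X), (e |: T); split.
- by rewrite subUset sub1set eF.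
- by rewrite cardsU1 eNT cT.
- by rewrite cardsU1 vX cX.
- move=> f /setU1P[->|/eT sfX]; last exact: subset_trans sfX (subsetU1 _ _).
  by rewrite eE subUset !sub1set setU11 setU1r.
have sT := connect_adjS (subsetU1 e T).
move=> z /setU1P[->|/rT/sT //].
apply: connect_trans (sT _ _ (rT _ uX)) _.
by apply/connect1/exists_inP; exists e; rewrite ?setU11 ?eE.
Qed.

Lemma spanning_tree F : span_connected F ->
  exists T, [/\ T \subset F, span_connected T & #|T|.+1 = #|vertex G|].
Proof.
move=> cF; have /andP[V0 _] := cF.
(* With this many edges, the partial tree has as many vertices as [G], so it spans. *)
have ltV : #|vertex G|.-1 < #|vertex G| by rewrite prednK.
have [r [X [T [sTF cT cX _ rT]]]] := partial_tree cF ltV.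
have XT : X = setT.
  by apply/eqP; rewrite eqEcard subsetT cX cardsT prednK ?leqnn.
exists T; split; rewrite ?cT ?prednK // /span_connected V0 /=.
apply/'forall_forallP => x y; apply: (@connect_trans _ _ r).
  by rewrite (sym_connect_sym (adj_sym T)); apply: rT; rewrite XT inE.
by apply: rT; rewrite XT inE.
Qed.

Lemma span_connected_card F : span_connected F -> #|vertex G| <= #|F|.+1.
Proof. by case/spanning_tree=> T [/subset_leq_card sTF _ <-]. Qed.

End SpanningTree.

(** A spanning tree is already connected, and stays so when any color class is added. *)
Lemma wld_le_tree (C : finType) (G : ecgraph C) : wld G <= #|vertex G| - 1.
Proof.
have [T [_ cT <-]] := spanning_tree (ecgraph_connected G).
rewrite subn1 /=; apply: (wldP G).2; apply/forallP => c.
exact: span_connectedS (subsetUl _ _) cT.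
Qed.

Lemma card_sum_colors (C : finType) (G : ecgraph C) (W : {set edge G}) :
  #|W| = \sum_c #|W :&: color_class G c|.
Proof.
rewrite -sum1_card (partition_big (@color C G) xpredT) //=.
by apply: eq_bigr => c _; rewrite -sum1_card; apply: eq_bigl => e; rewrite !inE.
Qed.

Theorem corollary6p3 (C : finType) (G : ecgraph C) (n m l s : nat)
    (hn : #|vertex G| = n) (hm : #|edge G| = m) (hl : #|C| = l) (hl2 : 2 <= l)
    (S : {set C}) (hS : #|S| = s) (hs : 0 < s)
    (honce : forall c, c \in S -> used_exactly G c 1)
    (htwice : forall c, c \notin S -> used_exactly G c 2)
    (hlt : n - 2 > l - s) :
  wld G = n - 1.
Proof.
apply/eqP; rewrite eqn_leq -{1}hn wld_le_tree /=.
have [[W /forallP ccW <-] _] := wldP G; rewrite leqNgt; apply/negP => ltW.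
(* If [W] contained the class of [c], adding that class would change nothing, so [W] itself would be
   connected with fewer than [n - 1] edges. *)
have ncW c : #|W :&: color_class G c| < #|color_class G c|.
  apply: proper_card; rewrite properEneq subsetIr andbT.
  apply: contraTneq ltW => /setIidPr scW.
  have := span_connected_card (ccW c).
  by rewrite (setUidPl scW) hn -leqNgt leq_subLR add1n.
(* Summing over colors, those in [S] contribute nothing and each of the others at most one edge. *)
have leW : #|W| <= l - s.
  rewrite card_sum_colors (bigID (mem S)) /= big1 => [|c cS]; last first.
    by apply/eqP; have := ncW c; rewrite (honce c cS) ltnS leqn0.
  have -> : l - s = #|~: S| by rewrite cardsCs setCK hl hS.
  rewrite add0n -sum1_card.
  rewrite (eq_bigl (mem (~: S))) => [|c]; last by rewrite !inE.
  by apply: leq_sum => c /setCP/negP cS; have := ncW c; rewrite (htwice c cS).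
(* Since [0 < s], some color class is a single edge; adding it to [W] gives a connected graph with
   at most [#|W| + 1] edges. *)
have [c cS] : exists c, c \in S by apply/card_gt0P; rewrite hS.
have := span_connected_card (ccW c); rewrite hn => len.
have leU : #|W :|: color_class G c| <= #|W|.+1.
  by rewrite cardsU (honce c cS) addn1 leq_subr.
have : n - 2 <= #|W| by rewrite leq_subLR (leq_trans len).
by rewrite leqNgt (leq_ltn_trans leW).
Qed.
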